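(* Let $\hat{\mathcal G}$ be the Pontryagin dual of a finite abelian group $\mathcal G$ of order $G$. Let $\mathcal D$ be a nonempty $D$-element subset of $\mathcal G$, and define vectors $\{\boldsymbol\varphi_\gamma\}_{\gamma\in\hat{\mathcal G}}$ in $\mathbb C^{\mathcal D}$ by $\boldsymbol\varphi_\gamma(d):=D^{-\frac12}\gamma(d)$ for $d\in\mathcal D$. For any subgroup $\mathcal H$ of $\mathcal G$ of order $H$, let $\mathcal H^\perp$ be its annihilator, and define $\mathcal D_g:=\mathcal H\cap(\mathcal D-g)$ for any $g\in\mathcal G$. Then $\{\boldsymbol\varphi_{\gamma'}\}_{\gamma'\in\gamma\mathcal H^\perp}$ is orthonormal for any one (equivalently, for all) $\gamma\in\hat{\mathcal G}$ if and only if the cardinality of $\mathcal D_g$ is independent of $g\in\mathcal G$. In this case, the sequence of subspaces $\{\mathcal U_{\gamma\mathcal H^\perp}\}_{\gamma\mathcal H^\perp\in\hat{\mathcal G}/\mathcal H^\perp}$, $\mathcal U_{\gamma\mathcal H^\perp}:=\operatorname{span}\{\boldsymbol\varphi_{\gamma'}\}_{\gamma'\in\gamma\mathcal H^\perp}$, is a $\mathrm{TFF}(D,H,\frac GH)$ for $\mathbb C^{\mathcal D}$ that is equichordal if and only if $\{\mathcal D_g\}_{g+\mathcal H\in\mathcal G/\mathcal H}$ is a difference family for $\mathcal H$, and is moreover equi-isoclinic if and only if each $\mathcal D_g$ is a difference set of $\mathcal H$. In particular, if $\mathcal D$ is a semiregular divisible difference set for $\mathcal G$ with respect to $\mathcal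 H$, then $\{\mathcal D_g\}_{g+\mathcal H\in\mathcal G/\mathcal H}$ is a difference family for $\mathcal H$.
   Context: The group operation of $\mathcal G$ is written as addition. The dual $\hat{\mathcal G}$ is the (multiplicative) group of homomorphisms $\gamma:\mathcal G\to\{z\in\mathbb C:|z|=1\}$; the annihilator of $\mathcal H$ is $\mathcal H^\perp:=\{\gamma\in\hat{\mathcal G}:\gamma(h)=1\ \forall h\in\mathcal H\}$, a subgroup of order $\frac GH$. $\mathbb C^{\mathcal D}$ carries the inner product $\langle \mathbf x_1,\mathbf x_2\rangle=\sum_{d\in\mathcal D}\overline{\mathbf x_1(d)}\mathbf x_2(d)$. Tight fusion frames: a $\mathrm{TFF}(D,N,R)$ for a $D$-dimensional complex Hilbert space is a sequence of $N$ subspaces of it, each of dimension $R$, whose orthogonal projections $\mathbf P_n$ sum to a positive multiple of the identity. It is equichordal if $\operatorname{Tr}(\mathbf P_{n_1}\mathbf P_{n_2})$ is constant over all $n_1\ne n_2$, and equi-isoclinic if there exists $\lambda\ge0$ with $\mathbf P_{n_1}\mathbf P_{n_2}\mathbf P_{n_1}=\lambda\mathbf P_{n_1}$ for all $n_1\neq n_2$. Difference families: a finite sequence $\{\mathcal D_r\}_{r\in\mathcal R}$ of subsets of a finite abelian group $\mathcal V$, all of the same cardinality, is a difference family for $\mathcal V$ if there is a constant $\Lambda$ such that $\sum_{r\in\mathcal R}\#\{(d_1,d_2)\in\mathcal D_r\times\mathcal D_r:d_1-d_2=v\}=\Lambda$ for all $v\in\mathcal V$, $v\ne0$. A subset $\mathcal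 E$ of $\mathcal V$ is a difference set for $\mathcal V$ if $\#\{(d_1,d_2)\in\mathcal E\times\mathcal E:d_1-d_2=v\}$ is constant over all $v\neq0$ in $\mathcal V$. The family $\{\mathcal D_g\}_{g+\mathcal H\in\mathcal G/\mathcal H}$ consists of one set $\mathcal D_g$ for each coset of $\mathcal H$, with $g$ an arbitrary representative of that coset (changing the representative only translates $\mathcal D_g$ by an element of $\mathcal H$, so the choice is immaterial). Divisible difference sets: $\mathcal D\subseteq\mathcal G$ is a divisible difference set for $\mathcal G$ with respect to the subgroup $\mathcal H$ if there are constants $\Lambda_1,\Lambda_2$ such that $\#\{(d_1,d_2)\in\mathcal D\times\mathcal D:g=d_1-d_2\}$ equals $\Lambda_1$ for all $g\in\mathcal H$, $g\neq0$, and equals $\Lambda_2$ for all $g\notin\mathcal H$. It is semiregular if $\mathcal H\ne\{0\}$, $D^2=G\Lambda_2$ and $D\neq\Lambda_1$, where $D=\#(\mathcal D)$. *)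

(* Defs.v *)
From HB Require Import structures.
From mathcomp Require Import all_boot all_order all_fingroup all_algebra.
From mathcomp Require Import cyclic.

Set Implicit Arguments.
Unset Strict Implicit.
Unset Printing Implicit Defensive.

Import Order.TTheory GRing.Theory Num.Theory.
Local Open Scope ring_scope.

(* Throughout, a finite abelian group is a [finZmodType] (written additively);
   its subgroups are the [{group G}] of its underlying finGroupType, whose
   (multiplicatively denoted) law is +%R. *)

Section Dual.
Variables (C : numClosedFieldType) (G : finZmodType).

Definition is_unitary_char (f : {ffun G -> C}) : bool :=
  [forall x, forall y, f (x + y) == f x * f y] && [forall x, `|f x| == 1].

Record dual_group : predArgType := DualChar {
  dual_fun :> {ffun G -> C};
  dual_funP : is_unitary_char dual_fun }.

HB.instance Definition _ := [isSub of dual_group for dual_fun].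
HB.instance Definition _ := [Choice of dual_group by <:].

Implicit Types c : dual_group.

Lemma dualD c x y : c (x + y) = c x * c y.
Proof. by case: c => f /= /andP[/forallP/(_ x)/forallP/(_ y)/eqP]. Qed.

Lemma dual_norm c x : `|c x| = 1.
Proof. by case: c => f /= /andP[_ /forallP/(_ x)/eqP]. Qed.

Lemma dual_neq0 c x : c x != 0.
Proof. by rewrite -normr_eq0 dual_norm oner_eq0. Qed.

Lemma dual0 c : c 0 = 1.
Proof.
by apply: (mulfI (dual_neq0 c 0)); rewrite -dualD addr0 mulr1.
Qed.

Lemma dualMn c x n : c (x *+ n) = c x ^+ n.
Proof.
by elim: n => [|n IHn]; rewrite ?mulr0n ?dual0 ?expr0 // mulrS dualD IHn exprS.
Qed.

(* Characters take values in the roots of X^#|G| - 1, whence the dual is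
   finite. *)
Definition dual_values : seq C :=
  sval (closed_field_poly_normal ('X^#|G| - 1 : {poly C})).

Lemma dual_valuesP c x : c x \in dual_values.
Proof.
rewrite /dual_values; case: closed_field_poly_normal => s /= Ds.
have G0 : (0 < #|G|)%N by apply/card_gt0P; exists 0.
have lc1 : lead_coef ('X^#|G| - 1 : {poly C}) = 1.
  by apply/eqP; rewrite -monicE -[1]/(1%:P) monicXnsubC.
have : root ('X^#|G| - 1 : {poly C}) (c x).
  rewrite rootE !hornerE ?hornerXn -dualMn.
  have -> : x *+ #|G| = 0.
    by rewrite -FinRing.zmodXgE -cardsT; apply: expg_cardG; rewrite inE.
  by rewrite dual0 subrr.
by rewrite Ds lc1 scale1r root_prod_XsubC.
Qed.

Definition dual_enc c : {ffun G -> seq_sub dual_values} :=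
  [ffun x => SeqSub (dual_valuesP c x)].

Definition dual_dec (F : {ffun G -> seq_sub dual_values}) : option dual_group :=
  insub [ffun x => ssval (F x)].

Lemma dual_encK : pcancel dual_enc dual_dec.
Proof.
move=> c; rewrite /dual_dec; have -> : [ffun x => ssval (dual_enc c x)] = val c.
  by apply/ffunP=> x; rewrite !ffunE.
by rewrite valK.
Qed.

HB.instance Definition _ : isCountable dual_group := PCanIsCountable dual_encK.
HB.instance Definition _ : isFinite dual_group := PCanIsFinite dual_encK.

Lemma dual_one_subproof : is_unitary_char [ffun=> 1].
Proof.
apply/andP; split; last by apply/forallP=> x; rewrite ffunE normr1.
by apply/forallP=> x; apply/forallP=> y; rewrite !ffunE mulr1.
Qed.

Lemma dual_mul_subproof c1 c2 : is_unitary_char [ffun x => c1 x * c2 x].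
Proof.
apply/andP; split; last first.
  by apply/forallP=> x; rewrite ffunE normrM !dual_norm mulr1.
by apply/forallP=> x; apply/forallP=> y; rewrite !ffunE !dualD mulrACA.
Qed.

Lemma dual_inv_subproof c : is_unitary_char [ffun x => (c x)^-1].
Proof.
apply/andP; split; last first.
  by apply/forallP=> x; rewrite ffunE normfV dual_norm invr1.
by apply/forallP=> x; apply/forallP=> y; rewrite !ffunE dualD invfM.
Qed.

Definition dual_one := DualChar dual_one_subproof.
Definition dual_mul c1 c2 := DualChar (dual_mul_subproof c1 c2).
Definition dual_inv c := DualChar (dual_inv_subproof c).

Lemma dual_mulA : associative dual_mul.
Proof. by move=> a b c; apply/val_inj/ffunP=> x; rewrite !ffunE mulrA. Qed.

Lemma dual_mul1 : left_id dual_one dual_mul.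
Proof. by move=> a; apply/val_inj/ffunP=> x; rewrite !ffunE mul1r. Qed.

Lemma dual_mulV : left_inverse dual_one dual_inv dual_mul.
Proof.
by move=> a; apply/val_inj/ffunP=> x; rewrite !ffunE mulVf ?dual_neq0.
Qed.

HB.instance Definition _ :=
  Finite_isGroup.Build dual_group dual_mulA dual_mul1 dual_mulV.

Definition annihilator (H : {set G}) : {set dual_group} :=
  [set c : dual_group | [forall h in H, c h == 1]].

Lemma annihilator_group_set (H : {set G}) : group_set (annihilator H).
Proof.
apply/group_setP; split=> [|a b].
  by rewrite inE; apply/forall_inP=> h _; rewrite ffunE.
rewrite !inE => /forall_inP Ha /forall_inP Hb; apply/forall_inP=> h hH.
by rewrite ffunE (eqP (Ha h hH)) (eqP (Hb h hH)) mulr1.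
Qed.

Canonical annihilator_group (H : {set G}) := Group (annihilator_group_set H).

End Dual.

Section FusionFrames.
Variables (C : numClosedFieldType) (n : nat) (I : finType).

(* Conjugate-linear in the first argument, whereas [dotmx] is conjugate-linear
   in the second. *)
Definition inner (x y : 'rV[C]_n) : C := dotmx y x.

Definition orthonormal_family (J : {set I}) (phi : I -> 'rV[C]_n) : Prop :=
  forall i j, i \in J -> j \in J -> inner (phi i) (phi j) = (i == j)%:R.

(* Subspaces of C^n are row spaces; [proj_ortho U] is the matrix, acting on row
   vectors from the right, of the orthogonal projection onto that of U. *)
Definition span_family (J : {set I}) (phi : I -> 'rV[C]_n) : 'M[C]_n :=
  (\sum_(i in J) <<phi i>>)%MS.

Definition is_TFF (N R : nat) (J : {set I}) (U : I -> 'M[C]_n) : Prop :=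
  [/\ #|J| = N,
      forall i, i \in J -> \rank (U i) = R
    & exists2 A : C, 0 < A & \sum_(i in J) proj_ortho (U i) = A%:M].

Definition equichordal (J : {set I}) (U : I -> 'M[C]_n) : Prop :=
  exists c : C, forall i j, i \in J -> j \in J -> i != j ->
    \tr (proj_ortho (U i) *m proj_ortho (U j)) = c.

Definition equi_isoclinic (J : {set I}) (U : I -> 'M[C]_n) : Prop :=
  exists2 lambda : C, 0 <= lambda &
    forall i j, i \in J -> j \in J -> i != j ->
    proj_ortho (U i) *m proj_ortho (U j) *m proj_ortho (U i)
      = lambda *: proj_ortho (U i).

End FusionFrames.

Arguments is_TFF {C} n {I} N R J U.

Section Differences.
Variable G : finZmodType.
Implicit Types (V H : {group G}) (D E : {set G}).

Definition ndiff E (v : G) : nat :=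
  #|[set p : G * G | [&& p.1 \in E, p.2 \in E & p.1 - p.2 == v]]|.

Definition difference_set V E : Prop :=
  E \subset V /\
  exists L : nat, forall v, v \in V -> v != 0 -> ndiff E v = L.

Definition difference_family V (I : finType) (J : {set I})
    (E : I -> {set G}) : Prop :=
  [/\ forall r, r \in J -> E r \subset V,
      forall r s, r \in J -> s \in J -> #|E r| = #|E s|
    & exists L : nat, forall v, v \in V -> v != 0 ->
        (\sum_(r in J) ndiff (E r) v)%N = L].

Definition divisible_difference_set H D (L1 L2 : nat) : Prop :=
  (forall g, g \in H -> g != 0 -> ndiff D g = L1) /\
  (forall g, g \notin H -> ndiff D g = L2).

Definition semiregular_dds H D : Prop :=
  exists L1 L2 : nat,
    [/\ divisible_difference_set H D L1 L2, H :!=: [set 0 : G],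
        (#|D| ^ 2 = #|G| * L2)%N & #|D| <> L1].

Definition slice H D (g : G) : {set G} := H :&: [set d - g | d in D].

End Differences.

(* C^D is realized as 'rV[C]_#|D|, coordinate i standing for the i-th element
   [enum_val i] of D. *)
Definition char_vec (C : numClosedFieldType) (G : finZmodType) (D : {set G})
    (c : dual_group C G) : 'rV[C]_#|D| :=
  \row_(i < #|D|) ((sqrtC #|D|%:R)^-1 * c (enum_val i)).

(* A is meant to be a coset of the annihilator of a subgroup. *)
Definition coset_space (C : numClosedFieldType) (G : finZmodType) (D : {set G})
    (A : {set dual_group C G}) : 'M[C]_#|D| :=
  span_family A (char_vec D).

(* Main.v *)
(* Characters of G separate points, so summing the characters in the annihilator
   K of H gives (|G|/|H|) times the indicator function of H.  Hence the functions
   g |-> #|D_g| and c |-> \sum_(d in D) c d, for c in K, are Fourier transforms of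
   each other, and the former is constant iff the latter vanishes off the trivial
   character, which is orthonormality.  In that case the projection P_a onto the
   coset space of a has entries k [y - x in H] a(y - x), for x, y in D and
   k = |G| / (|H| |D|), so that
     Tr(P_a P_b) = k^2 \sum_(v in H) #{x - y = v in D} (b/a)(v),
     P_a P_b P_a = P_a scaled in row x by
                   k^2 \sum_(v in H) #{y - z = v in D_x} (b/a)(v),
   and by Fourier inversion on H such a sum takes the same value at all b/a outside
   K iff the difference counts are constant on H \ {0}.  For a semiregular divisible
   difference set, #|D_g| is constant because its variance over g vanishes. *)
Require Import Defs.
From mathcomp Require Import all_boot all_order all_fingroup all_algebra.
From mathcomp Require Import reals complex ring.
Import Order.TTheory GRing.Theory Num.Theory.
Local Open Scope ring_scope.
Local Open Scope sesquilinear_scope.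

(** * Duality of finite abelian groups *)

Section Duality.
Context {C : numClosedFieldType} {G : finZmodType}.
Implicit Types (c : dual_group C G) (H : {group G}) (x y : G).

Lemma dualN c x : c (- x) = (c x)^*.
Proof.
apply: (mulfI (dual_neq0 c x)).
by rewrite -dualD subrr dual0 -normCK dual_norm expr1n.
Qed.

Lemma dualB c x y : c (x - y) = c x * (c y)^*.
Proof. by rewrite dualD dualN. Qed.

Lemma dual1E x : (1%g : dual_group C G) x = 1.
Proof. by rewrite ffunE. Qed.

Lemma dualM c1 c2 x : (c1 * c2)%g x = c1 x * c2 x.
Proof. by rewrite ffunE. Qed.

Lemma dualV c x : (c^-1)%g x = c (- x).
Proof.
apply: (mulfI (dual_neq0 c x)).
by rewrite ffunE divff ?dual_neq0 // -dualD subrr dual0.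
Qed.

Lemma dual_eqP c1 c2 : (forall x, c1 x = c2 x) -> c1 = c2.
Proof. by move=> eqc; apply/val_inj/ffunP. Qed.

(** Regular representation of [G]: right multiplication sends the basis row vector of [g] to that of
    [g + x]. *)
Definition shiftmx x : 'M[C]_#|G| :=
  \matrix_(i, j) (enum_val j == enum_val i + x)%:R.

Lemma shiftmxD x y : shiftmx x *m shiftmx y = shiftmx (x + y).
Proof.
apply/matrixP=> i j; rewrite !mxE (bigD1 (enum_rank (enum_val i + x))) //=.
rewrite !mxE enum_rankK eqxx mul1r addrA big1 ?addr0 // => k ne_k.
rewrite !mxE [enum_val k == _]negbTE ?mul0r //.
by apply: contraNneq ne_k => <-; rewrite enum_valK.
Qed.

Lemma shiftmx0 : shiftmx 0 = 1%:M.
Proof. by apply/matrixP=> i j; rewrite !mxE addr0 (inj_eq enum_val_inj) eq_sym. Qed.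

Lemma shiftmx_adj x : (shiftmx x)^t* = shiftmx (- x).
Proof.
apply/matrixP=> i j; rewrite !mxE conjC_nat; congr (_%:R).
by rewrite -subr_eq eq_sym.
Qed.

(* The shifts commute, so they are cotrigonalized by a unitary [P]; their adjoints
   are shifts too, so they are in fact diagonal in that basis, and the diagonal
   entries are characters. *)
Lemma dual_separates x : x != 0 -> exists c, c x != 1.
Proof.
move=> nz_x; apply/existsP; apply: contraNT nz_x.
rewrite negb_exists => /forallP triv_x.
have [|P uP /allP/= trig] := @cotrigonalization C _ [seq shiftmx y | y <- enum G].
  move=> _ _ /mapP[y _ ->] /mapP[z _ ->].
  by rewrite /comm_mx !shiftmxD addrC.
pose E y := P *m shiftmx y *m P^t*.
have E0 : E 0 = 1%:M by rewrite /E shiftmx0 mulmx1; apply/unitarymxP.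
have ED y z : E (y + z) = E y *m E z.
  by rewrite /E -shiftmxD !mulmxA mulmxKtV.
have Eadj y : (E y)^t* = E (- y).
  by rewrite /E !trmx_mul !map_mxM /= trmxCK mulmxA -shiftmx_adj.
have Etrig y (i j : 'I_#|G|) : (i < j)%N -> E y i j = 0.
  have : is_trig_mx (conjmx P (shiftmx y)).
    by apply: (trig (shiftmx y)); apply: map_f; rewrite mem_enum.
  by rewrite conjymx // => /is_trig_mxP; apply.
have Ediag y (i j : 'I_#|G|) : i != j -> E y i j = 0.
  rewrite neq_ltn => /orP[/Etrig //|lt_ji].
  by rewrite -[y]opprK -Eadj mxE mxE Etrig ?conjC0.
have EDii y z i : E (y + z) i i = E y i i * E z i i.
  rewrite ED mxE (bigD1 i) //= big1 ?addr0 // => k ne_k.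
  by rewrite Ediag 1?eq_sym // mul0r.
have Echar i : is_unitary_char [ffun y => E y i i].
  apply/andP; split; apply/forallP=> y.
    by apply/forallP=> z; rewrite !ffunE EDii.
  rewrite ffunE -(@eqrXn2 _ 2) ?normr_ge0 // expr1n normCK.
  have -> : (E y i i)^* = E (- y) i i by rewrite -Eadj [RHS]mxE [_^T _ _]mxE.
  by rewrite -EDii subrr E0 mxE eqxx.
have Ex : E x = 1%:M.
  apply/matrixP=> i j; rewrite [RHS]mxE.
  have [->|/Ediag //] := eqVneq i j.
  have := triv_x (DualChar (Echar j)).
  by rewrite negbK => /eqP; rewrite /= ffunE.
have : shiftmx x = 1%:M.
  have uP' := unitarymx_unit uP.
  apply: (can_inj (mulKmx uP')); rewrite mulmx1.
  by rewrite -[LHS](mulmxKtV _ uP) // -/(E x) Ex mul1mx.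
move/matrixP/(_ (enum_rank 0) (enum_rank 0)); rewrite !mxE eqxx !enum_rankK add0r.
by move/eqP; rewrite pnatr_eq1 eqb1 eq_sym.
Qed.

Lemma mem_addl H x y : x \in H -> (x + y \in H) = (y \in H).
Proof. exact: groupMl. Qed.

Lemma mem_addr H x y : x \in H -> (y + x \in H) = (y \in H).
Proof. exact: groupMr. Qed.

Lemma mem_opp H x : (- x \in H) = (x \in H).
Proof. exact: groupV. Qed.

Lemma annihilatorP H c :
  reflect (forall h, h \in H -> c h = 1) (c \in annihilator C H).
Proof.
rewrite inE; apply: (iffP forall_inP) => Hc h Hh; first exact/eqP/Hc.
by apply/eqP/Hc.
Qed.

(** Translation by [h0] in [H] multiplies the sum by [c h0], so the sum vanishes once some [c h0]
    differs from 1. *)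
Lemma sum_dual H c :
  \sum_(h in H) c h = if c \in annihilator C H then #|H|%:R else 0.
Proof.
case: ifPn => [/annihilatorP c1|].
  by rewrite (eq_bigr _ c1) sumr_const.
rewrite inE negb_forall_in => /exists_inP[h0 Hh0 c_h0].
have: (c h0 - 1) * \sum_(h in H) c h = 0.
  rewrite mulrBl mul1r mulr_sumr [X in _ - X](reindex_inj (addrI h0)) /=.
  apply/eqP; rewrite subr_eq0; apply/eqP/eq_big => [h|h _]; last by rewrite dualD.
  by rewrite mem_addl.
by move/eqP; rewrite mulf_eq0 subr_eq0 (negPf c_h0) => /eqP.
Qed.

Lemma sum_dual_all c : \sum_x c x = if c == 1%g then #|G|%:R else 0.
Proof.
have := sum_dual [group of [set: G]] c; rewrite cardsT.
under eq_bigl => x do rewrite in_setT.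
move->; congr (if _ then _ else _); apply/annihilatorP/eqP => [c1|-> h _].
  by apply: dual_eqP => x; rewrite c1 ?inE // dual1E.
exact: dual1E.
Qed.

Lemma sum_dualgroup_neq0 x : x != 0 -> \sum_(c : dual_group C G) c x = 0.
Proof.
case/dual_separates=> c0 c0x.
have: (c0 x - 1) * \sum_(c : dual_group C G) c x = 0.
  rewrite mulrBl mul1r mulr_sumr [X in _ - X](reindex_inj (mulgI c0)) /=.
  by apply/eqP; rewrite subr_eq0; apply/eqP/eq_bigr => c _; rewrite dualM.
by move/eqP; rewrite mulf_eq0 subr_eq0 (negPf c0x) => /eqP.
Qed.

Lemma sum_dualgroup x :
  \sum_(c : dual_group C G) c x = if x == 0 then #|G|%:R else 0.
Proof.
case: eqP => [->|/eqP]; last exact: sum_dualgroup_neq0.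
(* The order of the dual is not known yet. Only [x = 0] contributes to the double sum, so summing
   over [x] first reveals it. *)
transitivity (\sum_x \sum_(c : dual_group C G) c x).
  by rewrite [RHS](bigD1 0) //= [X in _ + X]big1 ?addr0 // => y /sum_dualgroup_neq0.
rewrite exchange_big /= (bigD1 1%g) // sum_dual_all eqxx.
rewrite big1 => [|c c1]; first exact: addr0.
by rewrite sum_dual_all (negPf c1).
Qed.

Lemma card_dual_group : #|dual_group C G| = #|G|.
Proof.
apply/eqP; rewrite -(eqr_nat C); have := sum_dualgroup 0; rewrite eqxx => <-.
by rewrite (eq_bigr _ (fun c _ => dual0 c)) sumr_const.
Qed.

Lemma card_subgroup_neq0 H : #|H|%:R != 0 :> C.
Proof. by rewrite pnatr_eq0 -lt0n cardG_gt0. Qed.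

(** A character sums over [H] to [#|H|] or 0 according to membership in the annihilator. Hence
    [#|H|] times the left side is the sum of [c (h + x)] over [h] in [H] and all [c], where only
    [h = - x] survives. *)
Lemma sum_annihilator H x :
  \sum_(c in annihilator C H) c x = if x \in H then #|G|%:R / #|H|%:R else 0.
Proof.
apply: (mulfI (card_subgroup_neq0 H)).
transitivity (\sum_(h in H) \sum_(c : dual_group C G) c (h + x)).
  rewrite exchange_big mulr_sumr big_mkcond /=; apply: eq_bigr => c _.
  under [RHS]eq_bigr do rewrite dualD.
  by rewrite -mulr_suml sum_dual; case: ifP => _; rewrite ?mul0r.
under eq_bigr do rewrite sum_dualgroup.
rewrite -big_mkcondr /=; case: ifPn => Hx.
  rewrite mulrC divfK ?card_subgroup_neq0 // (big_pred1 (- x)) // => h /=.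
  rewrite addr_eq0; case: eqP => [->|_]; last by rewrite andbF.
  by rewrite mem_opp Hx.
rewrite mulr0 big_pred0 // => h; apply: contraNF Hx => /andP[Hh].
by rewrite addr_eq0 -mem_opp => /eqP<-.
Qed.

Lemma card_annihilator H : #|annihilator C H| = (#|G| %/ #|H|)%N.
Proof.
have dvdHG : (#|H| %| #|G|)%N by rewrite -cardsT cardSg ?subsetT.
apply/eqP; rewrite -(eqr_nat C) natf_div //; have := sum_annihilator H 0.
by rewrite group1 (eq_bigr _ (fun c _ => dual0 c)) sumr_const => ->.
Qed.

End Duality.

(** * Orthonormal families and Fourier inversion *)

Section OrthonormalSpan.
Context {C : numClosedFieldType} {n : nat} {I : finType}.
Variables (J : {set I}) (phi : I -> 'rV[C]_n).
Hypothesis phiP : orthonormal_family J phi.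

Definition family_mx : 'M[C]_(#|J|, n) := \matrix_(k < #|J|) phi (enum_val k).

Lemma family_mx_unitary : family_mx \is unitarymx.
Proof.
apply/row_unitarymxP => i j; rewrite !rowK.
have := phiP _ _ (enum_valP j) (enum_valP i).
by rewrite /inner (inj_eq enum_val_inj) eq_sym.
Qed.

Lemma span_family_mx : (span_family J phi :=: family_mx)%MS.
Proof.
apply/eqmxP/andP; split.
  apply/sumsmx_subP=> i Ji; rewrite genmxE.
  by rewrite -(enum_rankK_in Ji Ji) -(rowK (fun k => phi (enum_val k))) row_sub.
apply/row_subP=> k; rewrite rowK -genmxE.
exact: (sumsmx_sup (enum_val k) (enum_valP k)).
Qed.

Lemma rank_span_orthonormal : \rank (span_family J phi) = #|J|.
Proof. by rewrite span_family_mx mxrank_unitary ?family_mx_unitary. Qed.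

(** With Q the matrix of the [phi i], the rows of [P], the adjoint of Q times Q, lie in the span,
    while those of [1 - P] are orthogonal to it. *)
Lemma proj_ortho_span :
  proj_ortho (span_family J phi) = \sum_(i in J) (phi i)^t* *m phi i.
Proof.
have uQ := unitarymxP family_mx_unitary.
pose P := family_mx^t* *m family_mx.
have -> : \sum_(i in J) (phi i)^t* *m phi i = P.
  apply/matrixP=> a b; rewrite summxE big_enum_val mxE; apply: eq_bigr => k _.
  by rewrite !mxE big_ord1 !mxE.
rewrite -[LHS]mul1mx -[X in X *m _](subrK P) addrC.
rewrite mulmxDl proj_ortho_id ?span_family_mx ?submxMl // proj_ortho_0 ?addr0 //.
rewrite (eqmx_ortho _ span_family_mx); apply/orthomx1P.
by rewrite mulmxBl mul1mx -mulmxA uQ mulmx1 subrr.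
Qed.

End OrthonormalSpan.

Section Fourier.
Context {C : numClosedFieldType} {G : finZmodType}.
Implicit Types (c : dual_group C G) (H : {group G}).

(** Subtracting [L] from [N] leaves the sum unchanged, as [c] sums to 0 over [H], and kills all
    terms but [v = 0]. *)
Lemma sum_dual_const H (N : G -> C) L c :
  (forall v, v \in H -> v != 0 -> N v = L) -> c \notin annihilator C H ->
  \sum_(v in H) N v * c v = N 0 - L.
Proof.
move=> NL Hc; have := sum_dual H c; rewrite (negPf Hc) => sum0.
have -> : \sum_(v in H) N v * c v = \sum_(v in H) (N v - L) * c v.
  by under [RHS]eq_bigr do rewrite mulrBl; rewrite sumrB -mulr_sumr sum0 mulr0 subr0.
rewrite (bigD1 0) ?group1 //=.
rewrite dual0 mulr1 big1 ?addr0 // => v /andP[Hv v0].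
by rewrite NL // subrr mul0r.
Qed.

(** Fourier inversion, carried out over the characters of [G] rather than those of [H]. *)
Lemma const_of_sum_dual H (N : G -> C) z :
  (forall c, c \notin annihilator C H -> \sum_(v in H) N v * c v = z) ->
  forall v w, v \in H -> w \in H -> v != 0 -> w != 0 -> N v = N w.
Proof.
move=> Nz; pose F1 := \sum_(v in H) N v.
(* The transform of [N] takes the value [F1] on the annihilator and [z] elsewhere. *)
have FE c : \sum_(v in H) N v * c v
    = z + (c \in annihilator C H)%:R * (F1 - z).
  have [/annihilatorP c1|/Nz->] := boolP (c \in _).
    rewrite mul1r addrC subrK; apply: eq_bigr => v Hv.
    by rewrite c1 ?mulr1.
  by rewrite mul0r addr0.
have Ninv w : w \in H -> w != 0 -> N w * #|G|%:R = (F1 - z) * (#|G|%:R / #|H|%:R).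
  move=> Hw w0.
  transitivity (\sum_(c : dual_group C G) (\sum_(v in H) N v * c v) * c (- w)).
    under [RHS]eq_bigr do rewrite mulr_suml.
    rewrite exchange_big /= (bigD1 w) //= [X in _ + X]big1 => [|v /andP[_ vw]].
      under eq_bigr do rewrite -mulrA -dualD subrr.
      by rewrite -mulr_sumr sum_dualgroup eqxx addr0.
    under eq_bigr do rewrite -mulrA -dualD.
    by rewrite -mulr_sumr sum_dualgroup subr_eq0 (negPf vw) mulr0.
  (* The constant [z] transforms back to 0 at [w != 0], and the indicator of the annihilator to a
     constant on [H]. *)
  under eq_bigr do rewrite FE mulrDl.
  rewrite big_split /= -mulr_sumr sum_dualgroup oppr_eq0 (negPf w0) mulr0 add0r.
  under eq_bigr do rewrite mulrAC mulrC.
  rewrite -mulr_sumr; congr (_ * _).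
  have := sum_annihilator (C := C) H (- w); rewrite mem_opp Hw => <-.
  rewrite [RHS]big_mkcond /=; apply: eq_bigr => c _.
  by case: (c \in _); rewrite ?mul1r ?mul0r.
move=> v w Hv Hw v0 w0; apply: (@mulIf _ #|G|%:R); last by rewrite !Ninv.
by rewrite pnatr_eq0 -lt0n; apply/card_gt0P; exists 0.
Qed.

End Fourier.

(** * Slices and difference counts *)

Section Slices.
Context {G : finZmodType}.
Implicit Types (H : {group G}) (D E X : {set G}) (g v x y : G).

Lemma ndiffE E v :
  ndiff E v = (\sum_(x in E) \sum_(y in E) (x - y == v)%R)%N.
Proof.
rewrite /ndiff -sum1_card pair_big /= big_mkcond [RHS]big_mkcond.
apply: eq_bigr => -[x y] _; rewrite inE /=.
by case: (x \in E); case: (y \in E); case: (_ == _).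
Qed.

Lemma sum_ndiff {C : nzRingType} (P : pred G) E (f : G -> C) :
  \sum_(v | P v) (ndiff E v)%:R * f v
    = \sum_(x in E) \sum_(y in E) (P (x - y))%:R * f (x - y).
Proof.
under eq_bigr do rewrite ndiffE natr_sum mulr_suml.
rewrite exchange_big; apply: eq_bigr => x _ /=.
under eq_bigr do rewrite natr_sum mulr_suml.
rewrite exchange_big; apply: eq_bigr => y _ /=.
rewrite big_mkcond (bigD1 (x - y)) //= eqxx mul1r big1 ?addr0 => [|v vxy].
  by case: (P _); rewrite ?mul1r ?mul0r.
by rewrite eq_sym (negPf vxy) mul0r if_same.
Qed.

Lemma sum_ndiff_nat (P : pred G) E :
  (\sum_(v | P v) ndiff E v = \sum_(x in E) \sum_(y in E) P (x - y)%R)%N.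
Proof.
apply/eqP; rewrite -(eqr_nat int) !natr_sum; apply/eqP.
transitivity (\sum_(v | P v) (ndiff E v)%:R * 1 : int).
  by apply: eq_bigr => v _; rewrite mulr1.
rewrite (sum_ndiff P E (fun _ => 1)); apply: eq_bigr => x _.
by rewrite natr_sum; apply: eq_bigr => y _; rewrite mulr1.
Qed.

Lemma ndiff0 E : ndiff E 0 = #|E|.
Proof.
rewrite ndiffE -sum1_card; apply: eq_bigr => x Ex.
rewrite (bigD1 x) //= subrr eqxx big1 ?addn0 // => y /andP[_ yx].
by rewrite subr_eq0 eq_sym (negPf yx).
Qed.

(** For each [x] only [y = x - v] counts. The bound later makes the isoclinic constant
    nonnegative. *)
Lemma ndiff_le E v : (ndiff E v <= #|E|)%N.
Proof.
rewrite ndiffE -sum1_card; apply: leq_sum => x Ex.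
rewrite big_mkcond (bigD1 (x - v)) //= big1 ?addn0 => [|y yxv].
  by case: (_ \in _); rewrite ?leq_b1.
rewrite subr_eq addrC -subr_eq eq_sym (negPf yxv).
by case: (_ \in _).
Qed.

Lemma mem_slice H D g x : (x \in slice H D g) = (x \in H) && (x + g \in D).
Proof.
rewrite inE; congr (_ && _); apply/imsetP/idP => [[d Dd ->]|Dx].
  by rewrite subrK.
by exists (x + g) => //; rewrite addrK.
Qed.

Lemma slice_sub H D g : slice H D g \subset H.
Proof. exact: subsetIl. Qed.

Lemma big_slice (T : Type) (idx : T) (op : Monoid.com_law idx) H D g (f : G -> T) :
  \big[op/idx]_(x in slice H D g) f x
    = \big[op/idx]_(d in D | d - g \in H) f (d - g).
Proof.
rewrite (reindex_inj (addIr (- g))) /=; apply: eq_bigl => d.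
by rewrite mem_slice subrK andbC.
Qed.

Lemma card_slice H D g : #|slice H D g| = (\sum_(d in D) (d - g \in H)%R)%N.
Proof. by rewrite -sum1_card big_slice big_mkcondr. Qed.

(** If [v] and [x - g] lie in [H], then [x - y = v] already puts [y - g] in [H], so one membership
    test suffices. *)
Lemma ndiff_slice H D g v : v \in H ->
  ndiff (slice H D g) v
    = (\sum_(x in D) \sum_(y in D) (x - g \in H)%R * (x - y == v)%R)%N.
Proof.
move=> Hv; rewrite ndiffE big_slice big_mkcondr; apply: eq_bigr => x _.
case: ifP => Hxg; last by rewrite big1.
rewrite big_slice big_mkcondr; apply: eq_bigr => y _.
rewrite mul1n opprB addrA subrK; case: eqP => [xyv|]; last by rewrite if_same.
have -> : y - g = - v + (x - g) by rewrite -xyv opprB addrA subrK.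
by rewrite mem_addl ?mem_opp // Hxg.
Qed.

Lemma transversal_sum1 H X x : is_transversal X (lcosets H [set: G]) [set: G] ->
  (\sum_(r in X) (x - r \in H)%R = 1)%N.
Proof.
case/and3P=> _ _ /forall_inP/(_ (x *: H)%g).
have -> : (x *: H)%g \in lcosets H [set: G].
  by apply/lcosetsP; exists x; rewrite ?inE.
move=> /(_ isT)/eqP <-.
rewrite -sum1_card big_mkcond [RHS]big_mkcond; apply: eq_bigr => r _.
rewrite inE mem_lcoset -mem_opp opprB addrC.
by case: (r \in X); case: (_ \in _).
Qed.

(** A pair of [D] with difference in [H] lies in a single coset of [H], hence is seen by exactly one
    representative. *)
Lemma sum_ndiff_slice H D X v : is_transversal X (lcosets H [set: G]) [set: G] ->
  v \in H -> (\sum_(r in X) ndiff (slice H D r) v = ndiff D v)%N.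
Proof.
move=> trX Hv; under eq_bigr do rewrite ndiff_slice //.
rewrite exchange_big ndiffE; apply: eq_bigr => x _ /=.
rewrite exchange_big; apply: eq_bigr => y _ /=.
by rewrite -big_distrl /= transversal_sum1 // mul1n.
Qed.

Lemma sum_mem_shift H x : (\sum_g (x - g \in H)%R = #|H|)%N.
Proof.
rewrite -sum1_card [RHS]big_mkcond (reindex_inj (subrI x)) /=.
by apply: eq_bigr => g _; rewrite opprB addrC subrK; case: (_ \in _).
Qed.

Lemma sum_card_slice H D : (\sum_g #|slice H D g| = #|H| * #|D|)%N.
Proof.
under eq_bigr do rewrite card_slice.
rewrite exchange_big /=; under eq_bigr do rewrite sum_mem_shift.
by rewrite sum_nat_const mulnC.
Qed.

(** Both [x - g] and [y - g] lie in [H] for [#|H|] values of [g] if [x - y] is in [H], and for none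
    otherwise. *)
Lemma sum_card_slice_sqr H D :
  (\sum_g #|slice H D g| ^ 2 = #|H| * \sum_(v in H) ndiff D v)%N.
Proof.
rewrite sum_ndiff_nat big_distrr /=.
under eq_bigr do rewrite card_slice expnS expn1 big_distrlr /=.
rewrite exchange_big; apply: eq_bigr => x _ /=; rewrite big_distrr /=.
rewrite exchange_big; apply: eq_bigr => y _ /=.
rewrite -(sum_mem_shift H x) big_distrl /=; apply: eq_bigr => g _.
have [Hxg|] := boolP (x - g \in H); last by rewrite !mul0n.
rewrite !mul1n; congr (nat_of_bool _).
have -> : y - g = (x - g) - (x - y) by rewrite opprB [RHS]addrC addrA subrK.
by rewrite mem_addl ?mem_opp.
Qed.

Lemma const_on_nonzeroP H (f : G -> nat) :
  (exists L, forall v, v \in H -> v != 0 -> f v = L) <->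
  (forall v w, v \in H -> w \in H -> v != 0 -> w != 0 -> f v = f w).
Proof.
split=> [[L fL] v w *|eqf]; first by rewrite !fL.
case: (boolP [exists v in H, v != 0]) => [/exists_inP[w Hw w0]|].
  by exists (f w) => v Hv v0; apply: eqf.
rewrite negb_exists_in => /forall_inP H0; exists 0%N => v /H0.
by move=> /negP.
Qed.

Lemma ndiff_slice_coset H D g d v : d - g \in H -> v \in H ->
  ndiff (slice H D g) v = ndiff (slice H D d) v.
Proof.
move=> Hdg Hv; rewrite !ndiff_slice //; apply: eq_bigr => x _.
by apply: eq_bigr => y _; rewrite -(mem_addr H _ (x - d) Hdg) addrA subrK.
Qed.

(** Counts all pairs of [E] by difference. As soon as [H] is nontrivial, the size of [E] thus
    determines [L]. *)
Lemma difference_set_card H E L : E \subset H ->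
  (forall v, v \in H -> v != 0 -> ndiff E v = L) ->
  (#|E| ^ 2 = #|E| + #|H|.-1 * L)%N.
Proof.
move=> /subsetP sEH EL.
transitivity (\sum_(v in H) ndiff E v)%N.
  rewrite sum_ndiff_nat -mulnn -sum_nat_const; apply: eq_bigr => x Ex.
  rewrite -sum1_card; apply: eq_bigr => y Ey.
  by rewrite mem_addl ?mem_opp ?sEH.
rewrite (bigD1 0) ?group1 //= ndiff0; congr (_ + _)%N.
rewrite (eq_bigr (fun=> L)) => [|v /andP[Hv v0]]; last exact: EL.
rewrite sum_nat_const (cardD1 (0 : G) H) group1 add1n /=; congr (_ * _)%N.
by apply: eq_card => v; rewrite !inE andbC.
Qed.

(** The first two moments of the slice sizes force their variance to be 0; the equality is cleared
    of denominators. *)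
Lemma semiregular_card_slice H D : semiregular_dds H D ->
  forall g, (#|G| * #|slice H D g| = #|H| * #|D|)%N.
Proof.
case=> L1 [L2 [[_ DL2] _ D2 _]].
(* The counts over all of [G] total [#|D| ^ 2 = #|G| * L2], and each element outside [H] accounts
   for [L2]. *)
have sumH : (\sum_(v in H) ndiff D v = #|H| * L2)%N.
  apply: (@addnI (\sum_(v in ~: H) ndiff D v)).
  transitivity (\sum_v ndiff D v)%N.
    rewrite [RHS](bigID (mem H)) /= addnC; congr (_ + _)%N.
    by apply: eq_bigl => v; rewrite inE.
  transitivity (#|D| ^ 2)%N.
    rewrite (sum_ndiff_nat predT) -mulnn -sum_nat_const; apply: eq_bigr => x _.
    by rewrite sum1_card.
  rewrite (eq_bigr (fun=> L2)) => [|v]; last by rewrite inE => /DL2.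
  by rewrite sum_nat_const -mulnDl D2 addnC cardsC.
(* The mean of [a] is [b], so [sum0] states that the variance is 0; [int] makes the subtraction
   exact. *)
pose a g : int := (#|G| * #|slice H D g|)%:R.
pose b : int := (#|H| * #|D|)%:R.
have sum0 : \sum_g (a g - b) ^+ 2 = 0.
  have suma : \sum_g a g = #|G|%:R * b.
    by rewrite -natr_sum -big_distrr /= sum_card_slice natrM.
  have suma2 : \sum_g a g ^+ 2 = #|G|%:R * b ^+ 2.
    under eq_bigr do rewrite -natrX expnMn.
    rewrite -natr_sum -big_distrr /= sum_card_slice_sqr sumH -natrX -natrM.
    by congr _%:R; rewrite expnMn D2; ring.
  under eq_bigr do rewrite sqrrB.
  rewrite big_split sumrB /= suma2 sumr_const sumrMnl -mulr_suml suma.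
  by rewrite -[b ^+ 2 *+ _]mulr_natl; ring.
move=> g; apply/eqP; rewrite -(eqr_nat int) -subr_eq0 -sqrf_eq0.
move: sum0 => /eqP; rewrite psumr_eq0 => [/allP/(_ g)|i _]; last exact: sqr_ge0.
by rewrite mem_index_enum => /(_ isT).
Qed.

End Slices.

(** * Equal slice sizes and vanishing character sums *)

Section Flatness.
Context {C : numClosedFieldType} {G : finZmodType}.
Implicit Types (c : dual_group C G) (H : {group G}) (D : {set G}).

Lemma dual_mulgC c1 c2 : (c1 * c2 = c2 * c1)%g.
Proof. by apply: dual_eqP => x; rewrite !dualM mulrC. Qed.

(** Each [d] satisfies [d - g \in H] for [#|H|] elements [g], all with [c g = c d]. *)
Lemma sum_card_slice_dual H D c : c \in annihilator C H ->
  \sum_g #|slice H D g|%:R * c g = #|H|%:R * \sum_(d in D) c d.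
Proof.
move=> /annihilatorP cH; under eq_bigr do rewrite card_slice natr_sum mulr_suml.
rewrite exchange_big /= mulr_sumr; apply: eq_bigr => d _.
rewrite (reindex_inj (subrI d)) /= -sum1_card natr_sum mulr_suml [RHS]big_mkcond.
apply: eq_bigr => h _; rewrite opprB addrC subrK.
by case: ifP => Hh; rewrite ?mul0r // dualB (cH h Hh) conjC1 mulr1 mul1r.
Qed.

Lemma card_slice_dual H D g :
  #|slice H D g|%:R * (#|G|%:R / #|H|%:R)
    = \sum_(c in annihilator C H) \sum_(d in D) c (d - g).
Proof.
rewrite card_slice natr_sum mulr_suml exchange_big /=; apply: eq_bigr => d _.
by rewrite sum_annihilator; case: ifP; rewrite ?mul1r ?mul0r.
Qed.

(** Orthogonality within a coset of the annihilator depends only on quotients of its characters;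
    this form no longer mentions the coset. *)
Definition char_sums_vanish H D :=
  forall c, c \in annihilator C H -> c != 1%g -> \sum_(d in D) c d = 0.

(** If the sums vanish, only [c = 1] is left in the inverse transform, and its term does not depend
    on [g]. Conversely, the transform of a constant vanishes at [c != 1]. *)
Lemma char_sums_vanishP H D :
  char_sums_vanish H D <-> (forall g1 g2, #|slice H D g1| = #|slice H D g2|).
Proof.
have nzq : #|G|%:R / #|H|%:R != 0 :> C.
  by rewrite mulf_neq0 ?invr_eq0 ?card_subgroup_neq0 // -cardsT card_subgroup_neq0.
split=> [van g1 g2|cst c Hc c1].
  apply/eqP; rewrite -(eqr_nat C) -(inj_eq (mulIf nzq)) !card_slice_dual; apply/eqP.
  apply: eq_bigr => c Hc; under eq_bigr do rewrite dualB.
  under [RHS]eq_bigr do rewrite dualB.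
  rewrite -!mulr_suml; have [->|c1] := eqVneq c 1%g; first by rewrite !dual1E.
  by rewrite van // !mul0r.
apply: (mulfI (card_subgroup_neq0 H)); rewrite mulr0 -sum_card_slice_dual //.
under eq_bigr do rewrite (cst _ 0).
by rewrite -mulr_sumr sum_dual_all (negPf c1) mulr0.
Qed.

End Flatness.

(** * Coset spaces *)

Lemma adjmxE {C : numClosedFieldType} m n (A : 'M[C]_(m, n)) i j :
  (A^t*) i j = (A j i)^*.
Proof. by rewrite !mxE. Qed.

Section HarmonicFrames.
Context {C : numClosedFieldType} {G : finZmodType}.
Variables (H : {group G}) (D : {set G}).
Hypothesis D_neq0 : D != set0.
Implicit Types (a b c : dual_group C G) (g v x y : G) (i j : 'I_#|D|).
Local Notation Hperp := (annihilator C H).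
Local Notation cosets := (lcosets Hperp [set: dual_group C G]).
Local Notation dv i := (@enum_val G (mem D) i).

Lemma card_natr_neq0 : #|D|%:R != 0 :> C.
Proof. by rewrite pnatr_eq0 cards_eq0. Qed.

Lemma char_vec_mul c1 c2 i j :
  (char_vec D c1 0 i)^* * char_vec D c2 0 j = #|D|%:R^-1 * ((c1 (dv i))^* * c2 (dv j)).
Proof.
rewrite !mxE rmorphM mulrACA; congr (_ * _).
by rewrite mulrC -normCK normfV ger0_norm ?sqrtC_ge0 ?ler0n // exprVn sqrtCK.
Qed.

Lemma inner_char_vec c1 c2 :
  inner (char_vec D c1) (char_vec D c2)
    = #|D|%:R^-1 * \sum_(d in D) (c1^-1 * c2)%g d.
Proof.
rewrite /inner dotmxE mxE mulr_sumr [RHS]big_enum_val; apply: eq_bigr => i _.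
by rewrite adjmxE mulrC char_vec_mul dualM dualV dualN.
Qed.

Lemma orthonormal_cosetP c :
  orthonormal_family (c *: Hperp)%g (char_vec D) <-> @char_sums_vanish C G H D.
Proof.
split=> [ortho e He e1|van a b].
  have := ortho c (c * e)%g; rewrite !mem_lcoset mulVg mulKg group1 He.
  move=> /(_ isT isT); rewrite inner_char_vec mulKg -[X in X == _]mulg1.
  rewrite (inj_eq (mulgI c)) eq_sym (negPf e1) => /eqP.
  by rewrite mulf_eq0 invr_eq0 (negPf card_natr_neq0) => /eqP.
rewrite !mem_lcoset => Ha Hb; rewrite inner_char_vec.
have [->|ab] := eqVneq a b.
  rewrite mulVg; under eq_bigr do rewrite dual1E.
  by rewrite sumr_const mulVf ?card_natr_neq0.
rewrite van ?mulr0 //.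
  by rewrite -[b](mulKVg c) mulgA groupM // -groupV invMg invgK.
by apply: contraNneq ab => /eqP; rewrite -eq_mulVg1.
Qed.

Lemma eq_lcoset_annihilator a b :
  ((a *: Hperp)%g == (b *: Hperp)%g) = ((b * a^-1)%g \in Hperp).
Proof.
by rewrite dual_mulgC -mem_lcoset (sameP eqP lcoset_eqP) lcoset_sym.
Qed.

Lemma card_cosets : #|cosets| = #|H|.
Proof.
rewrite card_lcosets -divgS ?subsetT // cardsT card_dual_group card_annihilator.
have dvdHG : (#|H| %| #|G|)%N by rewrite -cardsT cardSg ?subsetT.
rewrite -{1}(divnK dvdHG) mulKn // divn_gt0 ?cardG_gt0 //.
by rewrite -cardsT subset_leq_card ?subsetT.
Qed.

(** In the orthonormal case, the common diagonal entry of the coset projections: rank over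
    dimension. *)
Let k : C := #|G|%:R / #|H|%:R / #|D|%:R.

Lemma scale_gt0 : 0 < k.
Proof.
by rewrite !divr_gt0 ?ltr0n ?cardG_gt0 ?card_gt0 // -cardsT cardG_gt0.
Qed.

(** * Coset projections in the orthonormal case *)

Section FlatSlices.
Hypothesis sums0 : @char_sums_vanish C G H D.

Lemma proj_coset a i j :
  proj_ortho (coset_space D (a *: Hperp)%g) i j
    = k * ((dv j - dv i \in H)%:R * a (dv j - dv i)).
Proof.
rewrite /coset_space proj_ortho_span; last exact/orthonormal_cosetP.
rewrite summxE; transitivity (\sum_(c in (a *: Hperp)%g) #|D|%:R^-1 * c (dv j - dv i)).
  apply: eq_bigr => c _; rewrite mxE big_ord1 adjmxE char_vec_mul.
  by rewrite dualB [_ * _^*]mulrC.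
rewrite -mulr_sumr (reindex_inj (mulgI a)) /=.
rewrite (eq_bigl (mem Hperp)) => [|c]; last by rewrite mem_lcoset mulKg.
under eq_bigr do rewrite dualM.
rewrite -mulr_sumr sum_annihilator /k.
by case: (_ \in H); rewrite ?mul1r ?mul0r ?mulr0 // mulrCA mulrC [_^-1 * _]mulrC.
Qed.

Lemma coset_space_TFF : is_TFF #|D| #|H| (#|G| %/ #|H|)%N cosets (coset_space D).
Proof.
split; first exact: card_cosets.
  move=> _ /lcosetsP[c _ ->]; rewrite /coset_space rank_span_orthonormal.
    by rewrite card_lcoset card_annihilator.
  exact/orthonormal_cosetP.
(* The constant is forced by the trace: [#|H|] spaces of dimension [#|G| / #|H|] in dimension
   [#|D|]. *)
exists (#|G|%:R / #|D|%:R).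
  by rewrite divr_gt0 ?ltr0n ?card_gt0 // -cardsT cardG_gt0.
(* The cosets partition the dual, so the projections add up to the frame operator of all the
   [char_vec D c]. *)
transitivity (\sum_(c : dual_group C G) (char_vec D c)^t* *m char_vec D c).
  rewrite [RHS](partition_big (fun c => (c *: Hperp)%g) (mem cosets)) /=; last first.
    move=> c _; by apply/lcosetsP; exists c; rewrite ?inE.
  apply: eq_bigr => _ /lcosetsP[c _ ->]; rewrite /coset_space proj_ortho_span.
    by apply: eq_bigl => e; rewrite (sameP eqP lcoset_eqP).
  exact/orthonormal_cosetP.
apply/matrixP=> i j; rewrite summxE [RHS]mxE.
transitivity (\sum_(c : dual_group C G) #|D|%:R^-1 * c (dv j - dv i)).
  apply: eq_bigr => c _; rewrite mxE big_ord1 adjmxE char_vec_mul.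
  by rewrite dualB [_ * _^*]mulrC.
rewrite -mulr_sumr sum_dualgroup subr_eq0 (inj_eq enum_val_inj) eq_sym mulrC.
by case: (i == j); rewrite ?mulr0 ?mul0r ?mulr1n ?mulr0n.
Qed.

(** For [x], [y] in [D], two opposite entries contribute [a (y - x) * b (x - y)], which is
    [b * a^-1] at [x - y]. *)
Lemma mxtrace_proj_coset a b :
  \tr (proj_ortho (coset_space D (a *: Hperp)%g)
       *m proj_ortho (coset_space D (b *: Hperp)%g))
    = k ^+ 2 * \sum_(v in H) (ndiff D v)%:R * (b * a^-1)%g v.
Proof.
rewrite sum_ndiff mulr_sumr [RHS]big_enum_val; apply: eq_bigr => i _.
rewrite mxE mulr_sumr [RHS]big_enum_val; apply: eq_bigr => j _.
rewrite !proj_coset -[dv j - dv i]opprB mem_opp dualM dualV.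
by case: (_ \in H); rewrite /= ?mulr0n; ring.
Qed.

(** An entry sums over paths from [i] via [m] and [l] to [j] whose steps all lie in [H], so that
    both intermediate points stay in the coset of [dv i]. *)
Lemma proj_coset_triple a b i j :
  (proj_ortho (coset_space D (a *: Hperp)%g)
     *m proj_ortho (coset_space D (b *: Hperp)%g)
     *m proj_ortho (coset_space D (a *: Hperp)%g)) i j
    = k ^+ 2 * (\sum_(v in H) (ndiff (slice H D (dv i)) v)%:R * (b * a^-1)%g v)
      * proj_ortho (coset_space D (a *: Hperp)%g) i j.
Proof.
rewrite sum_ndiff big_slice big_mkcondr mulr_sumr mulr_suml [RHS]big_enum_val mxE.
apply: eq_bigr => l _; case: ifPn => Hl; last first.
  rewrite mulr0 mul0r mxE mulr_suml big1 // => m _; rewrite !proj_coset.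
  have [Hm|] := boolP (dv m - dv i \in H); last by rewrite !(mulr0n, mul0r, mulr0).
  rewrite -[dv l - dv m \in H](mem_addr H _ _ Hm) addrA subrK (negPf Hl).
  by rewrite !(mulr0n, mul0r, mulr0).
rewrite big_slice big_mkcondr mulr_sumr mulr_suml [RHS]big_enum_val mxE mulr_suml.
apply: eq_bigr => m _; rewrite !proj_coset opprB addrA subrK.
have [Hm|] := boolP (dv m - dv i \in H); last by rewrite !(mulr0n, mul0r, mulr0).
have -> : (dv l - dv m \in H) by rewrite -(mem_addr H _ _ Hm) addrA subrK.
have -> : (dv j - dv l \in H) = (dv j - dv i \in H).
  by rewrite -(mem_addr H _ (dv j - dv l) Hl) addrA subrK.
(* The value of [a] telescopes along the path; inserting [aV] turns [b] on the middle step into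
   [b * a^-1]. *)
have aji : a (dv j - dv i) = a (dv j - dv l) * a (dv l - dv m) * a (dv m - dv i).
  by rewrite -!dualD !subrKA.
have aV : a (dv l - dv m) * a (- (dv l - dv m)) = 1 by rewrite -dualD subrr dual0.
rewrite -[LHS]mulr1 -[X in _ * X = _]aV dualM dualV aji.
by case: (_ \in H); rewrite /= ?mulr0n; ring.
Qed.

Lemma equichordal_cosetP :
  equichordal cosets (coset_space D) <->
  (exists L, forall v, v \in H -> v != 0 -> ndiff D v = L).
Proof.
have nzk2 : k ^+ 2 != 0 by rewrite expf_neq0 // gt_eqF ?scale_gt0.
split=> [[z trz]|[L DL]].
  apply/const_on_nonzeroP => v w Hv Hw v0 w0; apply/eqP; rewrite -(eqr_nat C).
  apply/eqP; move: v w Hv Hw v0 w0.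
  apply: (@const_of_sum_dual C G H (fun v => (ndiff D v)%:R) (z / k ^+ 2)) => c Hc.
  have in_cosets e : (e *: Hperp)%g \in cosets.
    by apply/lcosetsP; exists e; rewrite ?inE.
  (* Against the trivial coset, every [c] outside the annihilator occurs as a quotient. *)
  have := trz _ _ (in_cosets 1%g) (in_cosets c).
  rewrite eq_lcoset_annihilator mxtrace_proj_coset invg1 mulg1 => /(_ Hc) <-.
  by rewrite mulrC mulKf.
exists (k ^+ 2 * (#|D|%:R - L%:R)) => _ _ /lcosetsP[a _ ->] /lcosetsP[b _ ->].
rewrite eq_lcoset_annihilator mxtrace_proj_coset => Hab; congr (_ * _).
rewrite (@sum_dual_const _ _ _ (fun v => (ndiff D v)%:R) L%:R) ?ndiff0 // => v Hv v0.
by rewrite DL.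
Qed.

(** All slices have the same size and one is nonempty, so none is empty. This supplies a row of the
    triple product for the coset of [g]. *)
Lemma coset_meets g : exists2 d, d \in D & d - g \in H.
Proof.
have [d0 Dd0] := set0Pn _ D_neq0.
have cst := proj1 (char_sums_vanishP (C := C) H D) sums0.
have : slice H D g != set0.
  rewrite -card_gt0 (cst g d0).
  by rewrite card_gt0; apply/set0Pn; exists 0; rewrite mem_slice group1 add0r.
case/set0Pn=> x; rewrite mem_slice => /andP[Hx Dxg].
by exists (x + g); rewrite ?addrK.
Qed.

Lemma equi_isoclinic_cosetP :
  equi_isoclinic cosets (coset_space D) <->
  (forall g, difference_set H (slice H D g)).
Proof.
have nzk : k != 0 by rewrite gt_eqF ?scale_gt0.
have nzk2 : k ^+ 2 != 0 by rewrite expf_neq0.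
have cst := proj1 (char_sums_vanishP (C := C) H D) sums0.
split=> [[z _ isoz] g|dset].
  split; first exact: slice_sub.
  apply/const_on_nonzeroP => v w Hv Hw v0 w0; apply/eqP; rewrite -(eqr_nat C).
  apply/eqP; move: v w Hv Hw v0 w0.
  have [d Dd Hdg] := coset_meets g.
  pose N v : C := (ndiff (slice H D g) v)%:R.
  apply: (@const_of_sum_dual C G H N (z / k ^+ 2)) => c Hc.
  have in_cosets e : (e *: Hperp)%g \in cosets.
    by apply/lcosetsP; exists e; rewrite ?inE.
  have := isoz _ _ (in_cosets 1%g) (in_cosets c).
  rewrite eq_lcoset_annihilator invg1 mulg1 => /(_ Hc) /matrixP.
  pose i := enum_rank_in Dd d; move/(_ i i).
  (* The diagonal entry of the projection is [k], which can be cancelled. *)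
  rewrite proj_coset_triple [RHS]mxE invg1 mulg1 enum_rankK_in // => /mulIf <- //.
    rewrite mulrC mulKf //; apply: eq_bigr => v Hv.
    by rewrite /N (ndiff_slice_coset _ _ _ _ _ Hdg).
  by rewrite proj_coset subrr group1 dual1E mulr1 mulr1.
have [H1|[v0 Hv0 nz0]] : (forall v, v \in H -> v = 0) \/ (exists2 v, v \in H & v != 0).
- case: (boolP [exists v in H, v != 0]) => [/exists_inP|]; first by right.
  rewrite negb_exists_in => /forall_inP H0; left=> v /H0.
  by rewrite negbK => /eqP.
(* For trivial [H] there is only one coset, and 0 serves vacuously. *)
- exists 0 => // _ _ /lcosetsP[a _ ->] /lcosetsP[b _ ->].
  rewrite eq_lcoset_annihilator => /negP[]; apply/annihilatorP => h /H1->.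
  exact: dual0.
pose L := ndiff (slice H D 0) v0.
(* A priori each slice has its own constant; equal sizes make them agree, since [#|H|.-1] is
   positive. *)
have sliceL g v : v \in H -> v != 0 -> ndiff (slice H D g) v = L.
  have [sH [Lg HLg]] := dset g; have [_ [L0 HL0]] := dset 0.
  have := difference_set_card _ _ _ sH HLg.
  rewrite (cst g 0) (difference_set_card _ _ _ (slice_sub H D 0) HL0).
  move=> /addnI/eqP; rewrite eqn_pmul2l; last first.
    rewrite -ltnS prednK ?cardG_gt0 // (cardD1 (0 : G)) (cardD1 v0).
    by rewrite !inE nz0 group1 Hv0.
  by move=> /eqP eqL Hv nzv; rewrite HLg // -eqL /L HL0.
exists (k ^+ 2 * (#|slice H D 0|%:R - L%:R)).
  by rewrite mulr_ge0 ?subr_ge0 ?ler_nat ?ndiff_le // exprn_ge0 // ltW // scale_gt0.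
move=> _ _ /lcosetsP[a _ ->] /lcosetsP[b _ ->].
rewrite eq_lcoset_annihilator => Hab; apply/matrixP => i j.
rewrite proj_coset_triple [RHS]mxE; congr (_ * _ * _).
rewrite (@sum_dual_const _ _ _ (fun v => (ndiff (slice H D _) v)%:R) L%:R) //.
  by rewrite ndiff0 (cst _ 0).
by move=> v Hv nzv; rewrite sliceL.
Qed.

End FlatSlices.
End HarmonicFrames.

Theorem theorem4p1 (R : realType) (G : finZmodType) (D : {set G})
  (hD : D != set0) (H : {group G}) :
  let Hperp : {set dual_group R[i] G} := annihilator R[i] H in
  let cosets : {set {set dual_group R[i] G}} :=
    lcosets Hperp [set: dual_group R[i] G] in
  let orthonormal_coset (c : dual_group R[i] G) :=
    orthonormal_family (c *: Hperp)%g (char_vec D) in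
  let constant_card :=
    forall g1 g2 : G, #|slice H D g1| = #|slice H D g2| in
  (* X is a set of representatives of the cosets of H in G *)
  let representatives (X : {set G}) :=
    is_transversal X (lcosets H [set: G]) [set: G] in
  [/\ (exists c, orthonormal_coset c) <-> constant_card,
      (forall c, orthonormal_coset c) <-> constant_card,
      constant_card ->
        [/\ is_TFF #|D| #|H| (#|G| %/ #|H|)%N cosets (coset_space D),
            forall X : {set G}, representatives X ->
              (equichordal cosets (coset_space D) <->
               difference_family H X (slice H D))
          & equi_isoclinic cosets (coset_space D) <->
            (forall g : G, difference_set H (slice H D g))]
    & semiregular_dds H D ->
        forall X : {set G}, representatives X ->
          difference_family H X (slice H D)].
Proof.
move=> Hperp cosets orthonormal_coset constant_card representatives.
have vanP := char_sums_vanishP (C := R[i]) H D.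
have orthoP c : orthonormal_coset c <-> constant_card.
  exact: iff_trans (orthonormal_cosetP H D hD c) vanP.
(* Summing over representatives turns the counts of the slices into those of [D] on [H], which
   govern equichordality. *)
have familyP X : representatives X -> constant_card ->
    (exists L, forall v, v \in H -> v != 0 -> ndiff D v = L) <->
    difference_family H X (slice H D).
  move=> trX cst; split=> [[L DL]|[_ _ [L DL]]].
    split=> [r _|r s _ _|]; [exact: slice_sub | exact: cst |].
    by exists L => v Hv v0; rewrite sum_ndiff_slice ?DL.
  by exists L => v Hv v0; rewrite -(sum_ndiff_slice _ _ _ _ trX) ?DL.
split.
- by split=> [[c /orthoP]|cst] //; exists 1%g; apply/orthoP.
- by split=> [ortho|cst c]; [apply/(orthoP 1%g) | apply/orthoP].
- move=> cst; have /vanP van := cst; split; first exact: coset_space_TFF.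
    by move=> X trX; rewrite -familyP //; apply: equichordal_cosetP.
  exact: equi_isoclinic_cosetP.
(* Semiregularity gives equal slice sizes, and the constant count [L1] on [H] gives the family. *)
move=> dds X trX; apply/(familyP X trX).
  move=> g1 g2; apply/eqP; rewrite -(eqn_pmul2l (m := #|G|)).
    by rewrite !(semiregular_card_slice _ _ dds).
  by apply/card_gt0P; exists 0.
by case: dds => L1 [L2 [[DL1 _] _ _ _]]; exists L1.
Qed.
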